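(* Let $\mathbb{Q}\subseteq L$ be a finite Galois extension of fields. Then the ring of algebraic integers $\mathcal{O}_L$ in $L$ (the integral closure of $\mathbb{Z}$ in $L$) is a D-ring.
   Context: All rings are commutative with identity. An integral domain $R$ with field of fractions $K$ is called a D-ring if, for all polynomials $f(x),g(x)\in R[x]$ with $g(x)\neq 0$ such that $g(k)\mid f(k)$ in $R$ for almost all $k\in R$ (i.e. for all but finitely many $k\in R$), one has $\frac{f(x)}{g(x)}\in K[x]$, i.e. $g(x)$ divides $f(x)$ in $K[x]$. *)

(* Defs.v *)
From HB Require Import structures.
From mathcomp Require Import all_boot all_order all_algebra all_field.
From mathcomp Require Import boolp classical_sets cardinality.

Set Implicit Arguments.
Unset Strict Implicit.
Unset Printing Implicit Defensive.

Import GRing.Theory.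
Local Open Scope ring_scope.
Local Open Scope classical_set_scope.

(* Plain divisibility in a ring; note that 0 divides 0. *)
Definition rdivides (R : comNzRingType) (a b : R) : Prop :=
  exists c : R, b = a * c.

(* In the conclusion, [%|] is divisibility over the fraction field. *)
Definition D_ring (R : idomainType) : Prop :=
  forall f g : {poly R}, g != 0 ->
    cofinite_set [set k : R | rdivides g.[k] f.[k]] ->
    map_poly (@tofrac R) g %| map_poly (@tofrac R) f.

Section RingOfIntegers.
Variable L : fieldType.

Definition algint : {pred L} :=
  fun x => `[< integralOver (intr : int -> L) x >].

Lemma algintP (x : L) :
  reflect (integralOver (intr : int -> L) x) (x \in algint).
Proof. exact: asboolP. Qed.

Fact algint_subring : subring_closed algint.
Proof.
split; first by apply/algintP; exact: (integral1 (intr : {rmorphism int -> L})).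
- move=> x y /algintP ix /algintP iy; apply/algintP.
  exact: (integral_sub (RtoK := (intr : {rmorphism int -> L}))).
- move=> x y /algintP ix /algintP iy; apply/algintP.
  exact: (integral_mul (RtoK := (intr : {rmorphism int -> L}))).
Qed.

HB.instance Definition _ := GRing.isSubringClosed.Build L algint algint_subring.

Record ring_of_integers : Type :=
  RingOfIntegers { roi_val :> L; roi_valP : roi_val \in algint }.

HB.instance Definition _ := [isSub for roi_val].
HB.instance Definition _ := [Choice of ring_of_integers by <:].
HB.instance Definition _ :=
  [SubChoice_isSubComNzRing of ring_of_integers by <:].

(* [idomainType] requires a total inverse fixing the non-units; the units are
   the nonzero integers whose inverse in [L] is again integral. *)
Definition roi_unit : {pred ring_of_integers} :=
  fun x => (val x != 0) && ((val x)^-1 \in algint).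

Definition roi_inv (x : ring_of_integers) : ring_of_integers :=
  if roi_unit x then insubd x (val x)^-1 else x.

Fact roi_mulVx : {in roi_unit, left_inverse 1 roi_inv *%R}.
Proof.
move=> x ux; rewrite /roi_inv (ux : roi_unit x).
by case/andP: ux => x0 ix; apply: val_inj; rewrite /= insubdK // mulVf.
Qed.

Fact roi_unitPl (x y : ring_of_integers) : y * x = 1 -> roi_unit x.
Proof.
move=> /(congr1 val) /= yx1; have x0 : val x != 0.
  by apply/eqP => x0; move/eqP: yx1; rewrite x0 mulr0 eq_sym oner_eq0.
rewrite /roi_unit x0 /=; suff -> : (val x)^-1 = val y by exact: valP.
by rewrite -[RHS](mulfK x0) yx1 mul1r.
Qed.

Fact roi_inv_out : {in [predC roi_unit], roi_inv =1 id}.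
Proof. by move=> x ux; rewrite /roi_inv (negbTE (ux : ~~ roi_unit x)). Qed.

HB.instance Definition _ := GRing.ComNzRing_hasMulInverse.Build
  ring_of_integers roi_mulVx roi_unitPl roi_inv_out.

Fact roi_integral : GRing.integral_domain_axiom ring_of_integers.
Proof.
by move=> x y /(congr1 val) /eqP /=; rewrite mulf_eq0 -!(inj_eq val_inj).
Qed.

HB.instance Definition _ :=
  GRing.ComUnitRing_isIntegral.Build ring_of_integers roi_integral.

End RingOfIntegers.

(* Main.v *)
Require Import Defs.
From mathcomp Require Import all_boot all_order all_algebra all_field.
From mathcomp Require Import boolp classical_sets cardinality ring.

(* If g does not divide f, removing their greatest common divisor gives a
   nonconstant g1 and a constant D != 0 with g1(k) | D for almost all k.  The
   product P of the Galois conjugates of g1 then takes, at almost all natural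
   numbers, integer values dividing the norm of D.  So P takes one of finitely
   many values infinitely often; hence P, and with it g1, is constant. *)

Set Implicit Arguments.
Unset Strict Implicit.
Unset Printing Implicit Defensive.

Import Order.TTheory GRing.Theory Num.Theory.
Local Open Scope ring_scope.

(** Over a domain [dvdp] means divisibility after scaling [q] by some nonzero [c]; in the fraction
    field [c] becomes invertible. *)
Lemma dvdp_map_tofrac (R : idomainType) (p q : {poly R}) :
  Pdiv.Idomain.dvdp p q ->
  map_poly (@tofrac R) p %| map_poly (@tofrac R) q.
Proof.
case/Pdiv.Idomain.dvdpP => -[c u] /= c0 e.
rewrite -(@dvdpZr _ (tofrac c)) ?tofrac_eq0 //.
by rewrite -map_polyZ e rmorphM /= dvdp_mull.
Qed.

Lemma poly_nat_roots0 (A : idomainType) (p : {poly A}) :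
  injective (fun k : nat => k%:R : A) ->
  (forall k : nat, p.[k%:R] = 0) -> p = 0.
Proof.
move=> natI pk; apply/eqP/negPn/negP => p0.
have := @max_poly_roots _ p [seq k%:R : A | k <- iota 0 (size p)] p0.
rewrite size_map size_iota ltnn map_inj_uniq // iota_uniq => H.
suff /H /(_ isT) : all (root p) [seq k%:R : A | k <- iota 0 (size p)] by [].
by apply/allP => _ /mapP[k _ ->]; apply/eqP.
Qed.

(** The roots of [h] stand for the excluded points. The product [q] of all [p - i] and [p + i] with
    [i <= n] vanishes at the remaining naturals, so [q * h] has infinitely many roots and is zero;
    hence some factor [p - i] or [p + i] is zero. *)
Lemma size_poly_bounded_int (A : idomainType) (p h : {poly A}) (n : nat) :
  injective (fun k : nat => k%:R : A) -> h != 0 ->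
  (forall k : nat, h.[k%:R] != 0 ->
     exists2 m : int, (`|m| <= n)%N & p.[k%:R] = m%:~R) ->
  (size p <= 1)%N.
Proof.
move=> natI h0 pk.
pose q := \prod_(i < n.+1) ((p - (i%:R)%:P) * (p + (i%:R)%:P)).
have : q * h = 0.
  apply: poly_nat_roots0 natI _ => k; rewrite hornerM.
  have [->|hk] := eqVneq h.[k%:R] 0; first by rewrite mulr0.
  have [m mn e] := pk k hk; rewrite horner_prod.
  have mn' : (`|m|%N < n.+1)%N by [].
  rewrite (bigD1 (Ordinal mn')) //= !hornerE e.
  suff -> : (m%:~R - `|m|%N%:R) * (m%:~R + `|m|%N%:R) = 0 :> A.
    by rewrite !mul0r.
  case: {e mn mn'} m => j; first by rewrite subrr mul0r.
  by rewrite NegzE abszN absz_nat intrN addNr mulr0.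
move/eqP; rewrite mulf_eq0 (negbTE h0) orbF => /prodf_eq0 [i _].
rewrite mulf_eq0 subr_eq0 addr_eq0 -polyCN => /orP[] /eqP ->;
  exact: size_polyC_leq1.
Qed.

Lemma nonconstant_dvd_const (R : idomainType) (f g : {poly R}) :
  g != 0 -> ~~ Pdiv.Idomain.dvdp g f ->
  exists (g1 h : {poly R}) (D : R),
    [/\ (1 < size g1)%N, h != 0, D != 0 &
        forall k, h.[k] != 0 -> rdivides g.[k] f.[k] -> rdivides g1.[k] D].
Proof.
move=> g0 ndv; set h := Pdiv.Idomain.gcdp f g.
have [[c1 f1] /= c10 ef] : exists2 c : R * {poly R}, c.1 != 0
  & c.1 *: f = c.2 * h by exact/Pdiv.Idomain.dvdpP/Pdiv.Idomain.dvdp_gcdl.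
have [[c2 g1] /= c20 eg] : exists2 c : R * {poly R}, c.1 != 0
  & c.1 *: g = c.2 * h by exact/Pdiv.Idomain.dvdpP/Pdiv.Idomain.dvdp_gcdr.
have [[u v] /= /Pdiv.Idomain.eqpP [[a b] /= /andP [a0 b0] ebez]] :=
  Pdiv.Idomain.Bezoutp f g.
rewrite -/h in ebez.
have g10h0 : g1 * h != 0 by rewrite -eg scale_poly_eq0 negb_or c20.
have [g10 h0] : g1 != 0 /\ h != 0.
  by move: g10h0; rewrite mulf_eq0 negb_or => /andP.
(* The Bezout identity for [f] and [g], scaled by [c1 * c2] and with [h] cancelled: the cofactors
   [f1] and [g1] combine to a nonzero constant. *)
have bez : (a * c2) *: (u * f1) + (a * c1) *: (v * g1) = (b * c1 * c2)%:P.
  apply: (mulIf h0); move: ef eg ebez; rewrite -!mul_polyC !rmorphM /=.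
  move=> ef eg ebez.
  transitivity (a%:P * c2%:P * u * (f1 * h) + a%:P * c1%:P * v * (g1 * h)).
    by ring.
  rewrite -ef -eg.
  transitivity (c1%:P * c2%:P * (a%:P * (u * f + v * g))); first by ring.
  by rewrite ebez; ring.
exists g1, h, (b * c1 * c2 * c1); split => //; last first.
- move=> k hk [d fk]; have := congr1 (fun p => p.[k]) ef.
  have := congr1 (fun p => p.[k]) eg; have := congr1 (fun p => p.[k]) bez.
  rewrite !(hornerD, hornerZ, hornerM, hornerC) fk => bk gk fk1.
  (* Cancelling [h.[k]] makes [g1.[k]] divide [c2 * f1.[k]], hence both terms of [bez] at [k]. *)
  have e1 : c2 * f1.[k] = c1 * (g1.[k] * d).
    apply: (mulIf hk); rewrite -mulrA -fk1.
    by transitivity (c1 * d * (c2 * g.[k])); [ring | rewrite gk; ring].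
  exists (c1 * (a * u.[k] * c1 * d + a * c1 * v.[k])); rewrite -bk.
  transitivity (c1 * (a * u.[k] * (c2 * f1.[k]) + a * c1 * (v.[k] * g1.[k]))).
    by ring.
  by rewrite e1; ring.
- by rewrite !mulf_neq0.
(* If [g1] were constant, [g] would equal the gcd [h] up to nonzero scalars and so divide [f]. *)
rewrite ltnNge; apply: contra ndv => /size1_polyC eg1.
have g1c : g1`_0 != 0 by rewrite -polyC_eq0 -eg1.
apply/Pdiv.Idomain.dvdpP; exists (g1`_0 * c1, c2 *: f1); first exact: mulf_neq0.
rewrite /= -scalerA ef -scalerAl [RHS]scalerAr eg [in RHS]eg1.
by rewrite mul_polyC -scalerAr.
Qed.

(** The monic integer polynomial killing [r] in [L] already kills it in [rat], hence in [algC],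
    where rational algebraic integers are known to be integers. *)
Lemma algint_rat (L : fieldExtType rat) (r : rat) :
  r%:A \in @algint L -> exists m : int, r = m%:~R.
Proof.
move/algintP => [p pm pr].
have pr' : root (map_poly (intr : int -> rat) p) r.
  rewrite -(fmorph_root (in_alg L)) -map_poly_comp.
  by rewrite (eq_map_poly (g := intr)) // => z; apply: (rmorph_int (in_alg L)).
have : (ratr r : algC) \in Aint.
  apply: (@root_monic_Aint (map_poly (intr : int -> algC) p)).
  - rewrite (_ : map_poly _ p = map_poly ratr (map_poly (intr : int -> rat) p)).
      by rewrite fmorph_root.
    by rewrite -map_poly_comp; apply: eq_map_poly => z /=; rewrite ratr_int.
  - exact: monic_map.
  by apply/polyOverP => i; rewrite coef_map /= intr_int.
move/(Cint_rat_Aint (Crat_rat r)) => /intrP [m em]; exists m.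
by apply: (fmorph_inj (@ratr algC)); rewrite /= em ratr_int.
Qed.

Lemma algint_rmorph (K L : fieldType) (s : {rmorphism K -> L}) (x : K) :
  x \in @algint K -> s x \in @algint L.
Proof.
move/algintP => [p pm pr]; apply/algintP; exists p => //.
rewrite (_ : map_poly _ p = map_poly s (map_poly (intr : int -> K) p)).
  by rewrite fmorph_root.
by rewrite -map_poly_comp; apply: eq_map_poly => z /=; rewrite rmorph_int.
Qed.

(** The norm is a product of integral conjugates, and it lies in the base field because the
    extension is Galois. *)
Lemma galNorm_algint_int (L : splittingFieldType rat) (x : L) :
  galois (1%AS : {subfield L}) fullv -> x \in @algint L ->
  exists m : int, galNorm 1 fullv x = m%:~R.
Proof.
move=> galL xi.
have Ni : galNorm 1 fullv x \in @algint L.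
  by rewrite /galNorm rpred_prod // => s _; apply: algint_rmorph.
have /vlineP [r er] := mem_galNorm galL (memvf x).
move: Ni; rewrite er => /algint_rat [m ->]; exists m.
by rewrite -(rmorph_int (in_alg L)).
Qed.

Lemma size_poly_dvd_const (L : splittingFieldType rat)
    (g h : {poly ring_of_integers L}) (D : ring_of_integers L) :
  galois (1%AS : {subfield L}) fullv -> h != 0 -> D != 0 ->
  (forall k : nat, h.[k%:R] != 0 -> rdivides g.[k%:R] D) ->
  (size g <= 1)%N.
Proof.
move=> galL h0 D0 gD; have [->|g0] := eqVneq g 0; first by rewrite size_poly0.
pose toL : {rmorphism ring_of_integers L -> L} := val.
have toLI : injective toL by exact: val_inj.
have natI : injective (fun k : nat => k%:R : L).
  move=> i j /eqP; rewrite -!(rmorph_nat (in_alg L)) (inj_eq (fmorph_inj _)).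
  by rewrite eqr_nat => /eqP.
pose P := \prod_(s in 'Gal(fullv / (1%AS : {subfield L}))%g)
            map_poly s (map_poly toL g).
have gL0 : map_poly toL g != 0 by rewrite map_poly_eq0_id0 // -(rmorph0 toL)
  (inj_eq toLI) lead_coef_eq0.
(* Automorphisms fix natural numbers, so at [k] the conjugates of [g] take the conjugate values of
   [g.[k]]. *)
have PE k : P.[k%:R] = galNorm 1 fullv (toL g.[k%:R]).
  rewrite horner_prod; apply: eq_bigr => s _.
  by rewrite -(rmorph_nat s) horner_map -(rmorph_nat toL) horner_map.
have [n en] := galNorm_algint_int galL (valP D).
have n0 : n != 0.
  apply/eqP => n0; move/eqP: en.
  by rewrite n0 galNorm_eq0 -(rmorph0 toL) (inj_eq toLI) (negbTE D0).
have P1 : (size P <= 1)%N.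
  apply: (@size_poly_bounded_int _ P (map_poly toL h) `|n|%N natI).
    by rewrite map_poly_eq0_id0 // -(rmorph0 toL) (inj_eq toLI) lead_coef_eq0.
  move=> k; rewrite -(rmorph_nat toL) horner_map -{1}(rmorph0 toL) (inj_eq toLI).
  move=> /gD [c eD]; rewrite rmorph_nat PE.
  have [m em] := galNorm_algint_int galL (valP g.[k%:R]).
  have [m' em'] := galNorm_algint_int galL (valP c).
  exists m => //; apply: dvdn_leq; first by rewrite absz_gt0.
  (* Taking norms in [D = g.[k] * c]. *)
  suff -> : n = m * m' by rewrite abszM dvdn_mulr.
  apply: (@intr_inj rat); apply: (fmorph_inj (in_alg L)).
  by rewrite !rmorph_int intrM -em -em' -en -galNormM -(rmorphM toL) -eD.
have P0 : P != 0 by apply/prodf_neq0 => s _; rewrite map_poly_eq0.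
(* The identity automorphism contributes [g] itself as a factor of [P]. *)
have gP : map_poly toL g %| P.
  have G1 : (1%g : gal_of fullv) \in 'Gal(fullv / (1%AS : {subfield L}))%g.
    exact: fingroup.group1.
  rewrite /P (bigD1 _ G1) /= map_poly_id; first exact: dvdp_mulIl.
  by move=> x _; rewrite gal_id.
by rewrite -(size_map_inj_poly toLI (rmorph0 toL)) (leq_trans (dvdp_leq P0 gP)).
Qed.

Theorem proposition1p3 (L : splittingFieldType rat)
    (galL : galois (1%AS : {subfield L}) fullv) :
  D_ring (ring_of_integers L).
Proof.
move=> f g g0 /finite_seqP [s es]; apply: dvdp_map_tofrac.
apply/negPn/negP => /(nonconstant_dvd_const g0) [g1 [h [D [g1s h0 D0 gD]]]].
move: g1s; rewrite ltnNge => /negP; apply.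
(* The list [s] holds the finitely many [k] where divisibility fails; the linear factors exclude
   them together with the roots of [h]. *)
apply: (@size_poly_dvd_const _ g1 (h * \prod_(a <- s) ('X - a%:P)) D) => //.
  by rewrite mulf_neq0 // monic_neq0 // monic_prod_XsubC.
move=> k; rewrite hornerM mulf_eq0 negb_or => /andP [hk sk].
apply: gD => //; apply: contrapT => nd.
have : (~` [set k : ring_of_integers L | rdivides g.[k] f.[k]])%classic k%:R.
  by [].
by rewrite es /= => ks; move: sk; rewrite -rootE root_prod_XsubC ks.
Qed.
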